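(* Let $(M,\theta)$ be a tension space, let $\tau,\sigma:M\to M$ be two commuting bijections such that $\theta(\tau(p),\sigma(p))>0$ for every $p\in M$, and let $(M_k)_{k\in\mathbb Z}$ be a $(\tau,\sigma)$-partition of $M$ with associated index function $\lfloor\cdot\rfloor:M\to\mathbb Z$. Let $\mathcal A\subset\mathbb R^M$ be an $\mathbb R$-algebra of functions with $\sigma^*\mathcal A\subset\mathcal A$ and $\tau^*\mathcal A\subset\mathcal A$, such that the $(\tau,\sigma)$-quantum derivative $D_{\tau,\sigma}$ and its right inverse $R_{\tau,\sigma}$ associated with the partition both map $\mathcal A$ into $\mathcal A$. Then the initial operator $F_{\tau,\sigma}$ induced by $D_{\tau,\sigma}$ and corresponding with $R_{\tau,\sigma}$ is given by $$F_{\tau,\sigma}f(p)=f\big((\tau\sigma^{-1})^{-\lfloor p\rfloor}(p)\big)$$ for $f\in\mathcal A$ and $p\in M$.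
   Context: A tension function on a nonempty set $M$ is a function $\theta:M\times M\to\mathbb R$ with $\theta(p_1,p_2)+\theta(p_2,p_3)=\theta(p_1,p_3)$ for all $p_1,p_2,p_3\in M$; the pair $(M,\theta)$ is called a tension space. Tension spaces are assumed nontrivial, i.e. $\theta(p,q)\ne 0$ for some $p,q\in M$. For a map $\alpha:M\to M$ and $f\in\mathbb R^M$, $\alpha^*f=f\circ\alpha$. Juxtaposition of maps on $M$ denotes composition, and integer powers denote iterates (negative powers: iterates of the inverse). The $(\tau,\sigma)$-quantum derivative is $$D_{\tau,\sigma}f(p)=\frac{f(\tau(p))-f(\sigma(p))}{\theta(\tau(p),\sigma(p))}.$$ A $(\tau,\sigma)$-partition of $M$ is a family of subsets $M_k\subset M$, $k\in\mathbb Z$, such that (1) $\bigcup_{k\in\mathbb Z}M_k=M$; (2) $M_{k_1}\cap M_{k_2}=\emptyset$ for $k_1\ne k_2$; (3) $\tau\sigma^{-1}$ restricts to a bijection $M_k\to M_{k+1}$ for every $k\in\mathbb Z$. Its index function is defined by $\lfloor p\rfloor=k$ iff $p\in M_k$. The right inverse $R_{\tau,\sigma}$ of $D_{\tau,\sigma}$ associated with the partition is defined by $$R_{\tau,\sigma}f(p)=\begin{cases}-\sum\limits_{m=0}^{-\lfloor p\rfloor-1}\theta\big(\tau^{m+1}\sigma^{-m-1}(p),\tau^m\sigma^{-m}(p)\big)\,f(\tau^m\sigma^{-m-1}(p)) & \text{if }\lfloor p\rfloor\le -1,\\[2mm] 0 & \text{if }\lfloor p\rfloor=0,\\[1mm]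 \sum\limits_{m=1}^{\lfloor p\rfloor}\theta\big(\tau^{-m+1}\sigma^{m-1}(p),\tau^{-m}\sigma^{m}(p)\big)\,f(\tau^{-m}\sigma^{m-1}(p)) & \text{if }\lfloor p\rfloor\ge 1.\end{cases}$$ For a linear operator $D$ in a real linear space $X$ with a right inverse $R:X\to X$ (that is, $DR=I$), an initial operator induced by $D$ is a linear operator $F:X\to X$ with $F^2=F$ and $\operatorname{Im}F=\ker D$; it corresponds to $R$ if $FR=0$, or equivalently if $F=I-RD$ on the domain of $D$. Here $X=\mathcal A$. *)

(* Defs.v *)
From mathcomp Require Import all_boot all_order all_algebra.
From mathcomp Require Import boolp classical_sets functions reals.

Set Implicit Arguments.
Unset Strict Implicit.
Unset Printing Implicit Defensive.

Import Order.TTheory GRing.Theory Num.Theory.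

Local Open Scope classical_set_scope.
Local Open Scope ring_scope.

(* For bijective f this is the two-sided inverse (surjpK, pinvKV). *)
Definition inv_map (M : Type) (f : M -> M) : M -> M := 'pinv_id [set: M] f.

(* f^k for k : int; recall that Negz n is - n.+1. *)
Definition ziter (M : Type) (f : M -> M) (k : int) : M -> M :=
  match k with
  | Posz n => iter n f
  | Negz n => iter n.+1 (inv_map f)
  end.

Section Tension.
Variables (R : realType) (M : Type).

(* Nontriviality entails that M is nonempty. *)
Definition tension_space (theta : M -> M -> R) : Prop :=
  (forall p1 p2 p3, theta p1 p2 + theta p2 p3 = theta p1 p3) /\
  (exists p q, theta p q != 0).

Definition partition_of (tau sigma : M -> M) (Mk : int -> set M) : Prop :=
  [/\ \bigcup_(k in [set: int]) Mk k = [set: M],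
      forall k1 k2, k1 != k2 -> Mk k1 `&` Mk k2 = set0 &
      forall k, set_bij (Mk k) (Mk (k + 1)) (tau \o inv_map sigma)].

Definition index_function (Mk : int -> set M) (idx : M -> int) : Prop :=
  forall p k, idx p = k <-> Mk k p.

Definition qderiv (theta : M -> M -> R) (tau sigma : M -> M) (f : M -> R) :
    M -> R :=
  fun p => (f (tau p) - f (sigma p)) / theta (tau p) (sigma p).

(* `|idx p| is the natural number - idx p in the first branch and idx p in
   the last one; upper summation bounds are exclusive. *)
Definition qright_inv (theta : M -> M -> R) (tau sigma : M -> M)
    (idx : M -> int) (f : M -> R) : M -> R :=
  fun p =>
    if (idx p <= -1)%R then
      - \sum_(0 <= m < `|idx p|%N)
          theta (ziter tau (m%:Z + 1) (ziter sigma (- m%:Z - 1) p))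
                (ziter tau m%:Z (ziter sigma (- m%:Z) p))
          * f (ziter tau m%:Z (ziter sigma (- m%:Z - 1) p))
    else if idx p == 0 then 0
    else
      \sum_(1 <= m < `|idx p|%N.+1)
          theta (ziter tau (- m%:Z + 1) (ziter sigma (m%:Z - 1) p))
                (ziter tau (- m%:Z) (ziter sigma m%:Z p))
          * f (ziter tau (- m%:Z) (ziter sigma (m%:Z - 1) p)).

(* R^o makes the pointwise linear structure of R^M inferable.
   No unit is required: the constants need not belong to A. *)
Definition function_algebra (A : set (M -> R^o)) : Prop :=
  [/\ A 0,
      forall (a : R) (f g : M -> R^o), A f -> A g -> A (a *: f + g) &
      forall f g : M -> R, A f -> A g -> A (f \* g)].

End Tension.

(* Operators on a linear subspace X of V are represented by total maps on V,
   of which only the restriction to X matters. *)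
Section RightInvertible.
Variables (K : pzRingType) (V : lmodType K) (X : set V).

Definition linear_operator (T : V -> V) : Prop :=
  (forall x, X x -> X (T x)) /\
  (forall (a : K) x y, X x -> X y -> T (a *: x + y) = a *: T x + T y).

Definition right_inverse_op (D Rinv : V -> V) : Prop :=
  [/\ linear_operator D,
      forall x, X x -> X (Rinv x) &
      forall x, X x -> D (Rinv x) = x].

Definition initial_operator (D F : V -> V) : Prop :=
  [/\ linear_operator F,
      forall x, X x -> F (F x) = F x &
      F @` X = [set x | X x /\ D x = 0]].

Definition corresponds_to (F Rinv : V -> V) : Prop :=
  forall x, X x -> F (Rinv x) = 0.

End RightInvertible.

(* Main.v *)
Require Import Defs.
From mathcomp Require Import all_boot all_order all_algebra.
From mathcomp Require Import boolp classical_sets functions reals.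

Set Implicit Arguments.
Unset Strict Implicit.
Unset Printing Implicit Defensive.

Import Order.TTheory GRing.Theory Num.Theory.

Local Open Scope classical_set_scope.
Local Open Scope ring_scope.

(** Write [rho] for [tau \o inv_map sigma].  Since [rho] sends [Mk k] onto
    [Mk (k + 1)], every [rho]-orbit meets [Mk 0] exactly once, and the point
    [ziter rho (- idx p) p] is where the orbit of [p] does.  As
    [tau q = rho (sigma q)], a function is killed by the quantum derivative iff it is
    constant along the [rho]-orbits ([qderiv_eq0]), and the right inverse is
    the discrete primitive along each orbit normalised to vanish on [Mk 0]
    ([qright_inv_rho], [qright_inv0]): its two sums collect the increments
    met when walking from the orbit's point of index [0] to [p].

    Consequently, for every [f] in the algebra, [h := f - Rinv (D f)] is in
    the kernel of [D], so that [h p] is the value of [h] where the orbit of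
    [p] meets [Mk 0]; there [h] agrees with [f], because [Rinv (D f)] vanishes.
    Thus [f - Rinv (D f)] is the composite of [f] with the projection of each
    orbit onto its point of index [0] ([sub_qright_inv_qderiv]).  Composition
    with that projection is an initial operator: it is idempotent because the
    projection is, and its image consists of the functions of the algebra that
    are constant along orbits, the kernel of [D].  It kills the image of
    [Rinv], whose members vanish on [Mk 0].  Any initial operator [F] with [F \o Rinv = 0] fixes
    [h], which is in the image of [F], and annihilates [Rinv (D f)], hence
    satisfies [F f = F h = h] ([initial_operatorE]). *)

(** * Iterates of a bijection *)

Section Iterates.
Variables (M : Type) (g : M -> M).
Hypothesis g_bij : bijective g.

Lemma inv_mapK : cancel g (inv_map g).
Proof.
by move=> x; apply: pinvKV; rewrite ?inE // => y z _ _; apply: bij_inj.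
Qed.

Lemma inv_mapVK : cancel (inv_map g) g.
Proof. by case: (g_bij) => g' _ g'K x; rewrite -(g'K x) inv_mapK. Qed.

Lemma inv_map_eq (g' : M -> M) : cancel g' g -> inv_map g =1 g'.
Proof. by move=> g'K x; rewrite -{1}(g'K x) inv_mapK. Qed.

Lemma ziterN (n : nat) : ziter g (- n%:Z) =1 iter n (inv_map g).
Proof. by case: n => [|n] x; rewrite -?NegzE. Qed.

Lemma ziter_invariant (T : Type) (h : M -> T) :
  (forall p, h (g p) = h p) -> forall k p, h (ziter g k p) = h p.
Proof.
move=> hg [n|n] p /=.
  by elim: n => //= n <-.
rewrite -iterS; elim: n.+1 => //= m <-.
by rewrite -[LHS]hg inv_mapVK.
Qed.

Lemma ziter_shift (ix : M -> int) :
  (forall p, ix (g p) = ix p + 1) -> forall k p, ix (ziter g k p) = ix p + k.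
Proof.
move=> ixg; have ixV p : ix (inv_map g p) = ix p - 1.
  by rewrite -{2}(inv_mapVK p) ixg addrK.
move=> [n|n] p /=.
  elim: n => [|n IHn] /=; first by rewrite addr0.
  by rewrite ixg IHn -addrA -PoszD addn1.
rewrite -iterS NegzE; elim: n.+1 => [|m IHm] /=; first by rewrite subr0.
by rewrite ixV IHm -addrA -opprD -PoszD addn1.
Qed.

End Iterates.

Lemma iter_comp (M : Type) (a b : M -> M) :
  (forall x, a (b x) = b (a x)) ->
  forall n x, iter n a (iter n b x) = iter n (a \o b) x.
Proof.
move=> ab; elim=> // n IHn x; rewrite [RHS]iterS -IHn /=; congr a.
by elim: n (iter n b x) {IHn} => //= n IHn y; rewrite IHn ab.
Qed.

(** * The quantum derivative and its right inverse along orbits *)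

Section QuantumCalculus.
Variables (R : realType) (M : Type) (theta : M -> M -> R) (tau sigma : M -> M).
Hypotheses (tau_bij : bijective tau) (sigma_bij : bijective sigma).
Hypothesis tau_sigma : forall p, tau (sigma p) = sigma (tau p).
Hypothesis theta_pos : forall p, 0 < theta (tau p) (sigma p).

Let rho : M -> M := tau \o inv_map sigma.

Lemma rho_bij : bijective rho.
Proof.
exists (sigma \o inv_map tau) => x; rewrite /rho /=.
  by rewrite inv_mapK // inv_mapVK.
by rewrite inv_mapK // inv_mapVK.
Qed.

Lemma rho_sigma p : rho (sigma p) = tau p.
Proof. by rewrite /rho /= inv_mapK. Qed.

Lemma tau_inv_sigma p : tau (inv_map sigma p) = inv_map sigma (tau p).
Proof. by rewrite -{2}(inv_mapVK sigma_bij p) tau_sigma inv_mapK. Qed.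

Lemma inv_tau_sigma p : inv_map tau (sigma p) = sigma (inv_map tau p).
Proof. by rewrite -{1}(inv_mapVK tau_bij p) -tau_sigma inv_mapK. Qed.

Lemma inv_rhoE : inv_map rho =1 inv_map tau \o sigma.
Proof.
move=> x; apply: (inv_map_eq rho_bij) => {}x.
by rewrite /rho /= inv_tau_sigma inv_mapK // inv_mapVK.
Qed.

Lemma iter_rho n p : iter n tau (iter n (inv_map sigma) p) = iter n rho p.
Proof. exact/iter_comp/tau_inv_sigma. Qed.

Lemma iter_inv_rho n p :
  iter n (inv_map tau) (iter n sigma p) = iter n (inv_map rho) p.
Proof. by rewrite (iter_comp inv_tau_sigma) (eq_iter inv_rhoE). Qed.

(** The increment on the step of an orbit that ends at [p]: the point [q] with
    [tau q = p] has [sigma q = inv_map rho p], and the quantum derivative at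
    [q] is the difference quotient over exactly this step. *)
Definition orbit_increment (f : M -> R) (p : M) : R :=
  theta p (inv_map rho p) * f (inv_map tau p).

Lemma qderivK f q :
  qderiv theta tau sigma f q * theta (tau q) (sigma q)
    = f (tau q) - f (sigma q).
Proof. by rewrite /qderiv divfK // gt_eqF. Qed.

Lemma qderiv_linear a (f g : M -> R^o) :
  qderiv theta tau sigma (a *: f + g)
    = a *: (qderiv theta tau sigma f : M -> R^o) + qderiv theta tau sigma g.
Proof.
apply/funext => p; rewrite /qderiv !fctE /GRing.scale /=.
by rewrite opprD addrACA -mulrBr mulrDl mulrA.
Qed.

Lemma qderiv_eq0 f :
  (forall q, qderiv theta tau sigma f q = 0) <-> (forall p, f (rho p) = f p).
Proof.
split=> [Df0 p|f_inv q]; last by rewrite /qderiv -rho_sigma f_inv subrr mul0r.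
apply/eqP; rewrite -subr_eq0 -{2}(inv_mapVK sigma_bij p) -qderivK.
by rewrite Df0 mul0r.
Qed.

Section Index.
Variables (Mk : int -> set M) (idx : M -> int).
Hypothesis Mk_part : partition_of tau sigma Mk.
Hypothesis idxP : index_function Mk idx.

Lemma idx_rho p : idx (rho p) = idx p + 1.
Proof.
case: Mk_part => _ _ /(_ (idx p)) [rho_fun _ _].
by apply/idxP/rho_fun/idxP.
Qed.

Definition orbit_base (p : M) : M := ziter rho (- idx p) p.

Lemma idx_orbit_base p : idx (orbit_base p) = 0.
Proof. by rewrite (ziter_shift rho_bij idx_rho) subrr. Qed.

Lemma orbit_base_id p : idx p = 0 -> orbit_base p = p.
Proof. by rewrite /orbit_base => ->. Qed.

Lemma qright_inv0 f p : idx p = 0 -> qright_inv theta tau sigma idx f p = 0.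
Proof. by rewrite /qright_inv => ->. Qed.

(** As [tau] and [sigma] commute, the powers of [tau] and of [inv_map sigma]
    in each summand combine into powers of [rho], up to the one unmatched
    factor [inv_map tau] of [orbit_increment].  Hence every summand is the
    increment of a single step of the orbit. *)
Lemma qright_invE f p :
  qright_inv theta tau sigma idx f p =
  match idx p with
  | Posz n => \sum_(m < n) orbit_increment f (iter m (inv_map rho) p)
  | Negz n => - \sum_(m < n.+1) orbit_increment f (iter m.+1 rho p)
  end.
Proof.
rewrite /qright_inv /orbit_increment; case: (idx p) => [[|n]|n].
- by rewrite big_ord0.
- rewrite /= big_add1 big_mkord; apply: eq_bigr => m _.
  have -> : - (m.+1%:Z) + 1 = - m%:Z by rewrite -addn1 PoszD opprD addrK.
  have -> : m.+1%:Z - 1 = m%:Z by rewrite -addn1 PoszD addrK.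
  rewrite !ziterN /ziter !iter_inv_rho.
  by rewrite iterS -iter_inv_rho.
- rewrite NegzE lerN2 lez_nat ltn0Sn abszN absz_nat big_mkord; congr (- _).
  apply: eq_bigr => m _.
  have -> : m%:Z + 1 = m.+1%:Z by rewrite -PoszD addn1.
  have -> : - m%:Z - 1 = - m.+1%:Z by rewrite -opprD -PoszD addn1.
  rewrite !ziterN /ziter !iter_rho.
  rewrite [in RHS](inv_mapK rho_bij (iter m rho p)).
  by congr (_ * f _); rewrite -iter_rho iterS inv_mapK.
Qed.

(** Passing from [p] to [rho p] prepends the increment at [rho p] to the sum of
    nonnegative index, or removes it from the subtracted sum of negative
    index. *)
Lemma qright_inv_rho f p :
  qright_inv theta tau sigma idx f (rho p) =
  qright_inv theta tau sigma idx f p + orbit_increment f (rho p).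
Proof.
rewrite !qright_invE idx_rho; case: (idx p) => [n|n].
  rewrite -PoszD addn1 big_ord_recl addrC; congr (_ + _).
  apply: eq_bigr => m _.
  by rewrite [LHS]/= -iterS iterSr inv_mapK //; exact: rho_bij.
rewrite big_ord_recl opprD addrAC addNr add0r.
case: n => [|n]; first by rewrite big_ord0 oppr0 [LHS]big_ord0.
have -> : Negz n.+1 + 1 = Negz n by rewrite !NegzE -addn1 PoszD opprD addrNK.
by congr (- _); apply: eq_bigr => m _; rewrite -iterSr.
Qed.

Lemma qderiv_qright_inv f :
  qderiv theta tau sigma (qright_inv theta tau sigma idx f) = f.
Proof.
apply/funext => q; rewrite /qderiv -{1}rho_sigma qright_inv_rho addrC addKr.
rewrite rho_sigma /orbit_increment inv_rhoE /= inv_tau_sigma !inv_mapK //.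
by rewrite mulrAC divff ?mul1r // gt_eqF.
Qed.

(** Both sides agree on the points of index [0], where the primitive vanishes,
    and the left one is constant on orbits since its derivative is zero. *)
Lemma sub_qright_inv_qderiv f p :
  f p - qright_inv theta tau sigma idx (qderiv theta tau sigma f) p
    = f (orbit_base p).
Proof.
set Df := qderiv theta tau sigma f.
pose h q := f q - qright_inv theta tau sigma idx Df q.
have h_rho q : h (rho q) = h q.
  rewrite /h qright_inv_rho /orbit_increment inv_mapK; last exact: rho_bij.
  have -> : theta (rho q) q * Df (inv_map tau (rho q)) = f (rho q) - f q.
    rewrite -(inv_mapVK sigma_bij q) rho_sigma inv_mapK // mulrC.
    exact: qderivK.
  by rewrite opprD addrCA opprB subrKC addrC.
rewrite -[LHS]/(h p) -(ziter_invariant rho_bij h_rho (- idx p) p).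
by rewrite /h qright_inv0 ?subr0 //; exact: idx_orbit_base.
Qed.

End Index.
End QuantumCalculus.

(** * Initial operators *)

(** The complementary projection [I - Rinv D] is the only candidate: [F] fixes
    [x - Rinv (D x)], a vector of [ker D = F @` X], and kills [Rinv (D x)]. *)
Lemma initial_operatorE (K : pzRingType) (V : lmodType K) (X : set V)
    (D Rinv F : V -> V) :
  (forall (a : K) x y, X x -> X y -> X (a *: x + y)) ->
  right_inverse_op X D Rinv -> initial_operator X D F ->
  corresponds_to X F Rinv ->
  forall x, X x -> F x = x - Rinv (D x).
Proof.
move=> X_lin [[XD D_lin] XR DR] [[_ F_lin] FF F_im] FR x Xx.
have XRD : X (Rinv (D x)) by apply/XR/XD.
have subE : x - Rinv (D x) = (-1) *: Rinv (D x) + x by rewrite scaleN1r addrC.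
have [y Xy Fy] : (F @` X) (x - Rinv (D x)).
  rewrite F_im; split; rewrite subE; first exact: X_lin.
  by rewrite D_lin // DR ?scaleN1r ?addNr //; exact: XD.
rewrite -[RHS]Fy -(FF y Xy) Fy subE F_lin // FR ?scaler0 ?add0r //.
exact: XD.
Qed.

Theorem proposition6p11 (R : realType) (M : Type) (theta : M -> M -> R)
    (tau sigma : M -> M) (Mk : int -> set M) (idx : M -> int)
    (A : set (M -> R^o)) :
  tension_space theta ->
  bijective tau -> bijective sigma ->
  (forall p, tau (sigma p) = sigma (tau p)) ->
  (forall p, 0 < theta (tau p) (sigma p)) ->
  partition_of tau sigma Mk ->
  index_function Mk idx ->
  function_algebra A ->
  (forall f, A f -> A (f \o sigma)) ->
  (forall f, A f -> A (f \o tau)) ->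
  (forall f, A f -> A (qderiv theta tau sigma f)) ->
  (forall f, A f -> A (qright_inv theta tau sigma idx f)) ->
  let D := qderiv theta tau sigma in
  let Rinv := qright_inv theta tau sigma idx in
  [/\ right_inverse_op A D Rinv,
      exists F : (M -> R^o) -> (M -> R^o),
        initial_operator A D F /\ corresponds_to A F Rinv &
      forall F : (M -> R^o) -> (M -> R^o),
        initial_operator A D F -> corresponds_to A F Rinv ->
        forall (f : M -> R) (p : M), A f ->
          F f p = f (ziter (tau \o inv_map sigma) (- idx p) p)].
Proof.
move=> _ tau_bij sigma_bij tau_sigma theta_pos Mk_part idxP [_ A_lin _] _ _.
move=> AD AR D Rinv.
pose base := orbit_base tau sigma idx.
have subE f p : f p - Rinv (D f) p = f (base p).
  exact: (sub_qright_inv_qderiv tau_bij sigma_bij tau_sigma theta_pos Mk_part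
            idxP).
have R_right : right_inverse_op A D Rinv.
  split=> [|//|f _]; last exact: qderiv_qright_inv Mk_part idxP f.
  by split=> // a f g _ _; exact: qderiv_linear.
have idx_base p : idx (base p) = 0 by exact: idx_orbit_base Mk_part idxP p.
split=> //; last first.
  move=> F F_init FR f p Af.
  by rewrite (initial_operatorE A_lin R_right F_init FR Af) [LHS]subE.
have baseE (f : M -> R^o) : f \o base = (-1) *: (Rinv (D f) : M -> R^o) + f.
  by apply/funext => p; rewrite /= -subE scaleN1r addrC.
exists (fun f => f \o base); split; last first.
  by move=> f _; apply/funext => p; exact: qright_inv0.
have A_base f : A f -> A (f \o base).
  by move=> Af; rewrite baseE; apply: A_lin => //; apply/AR/AD.
split=> [|f _|]; first by split.
  by apply/funext => p /=; rewrite /base (orbit_base_id _ _ (idx_base p)).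
apply/seteqP; split=> [_ [f Af <-]|f [Af Df0]].
  split; first exact: A_base.
  have [_ _ DR] := R_right.
  rewrite baseE [LHS]qderiv_linear -/D DR; last exact: AD.
  by rewrite scaleN1r addNr.
exists f => //; apply/funext => p; apply: (ziter_invariant (rho_bij _ _)) => //.
by apply/(qderiv_eq0 sigma_bij theta_pos) => q; rewrite -/D Df0.
Qed.
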